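(* Let $\mathcal K\in\Sigma_d^0$ and let $g$ be either the constant function $g(s)=1$ (uniform stability) or $g(s)=s$ (non-uniform stability). For $w_0\in X_2\times X_1$ let $w$ be the solution of the damped system $w'(t)=(\mathcal A-\mathcal C^*\mathcal C)w(t)$, $w(0)=w_0$, and let $U(t)=e^{t\mathcal A}w_0$ be the solution of the undamped system with the same initial datum. Suppose that $$\|w(t)\|_{X_1\times X}^2\le\mathcal K(t)\,g(\mu(w_0))\,\|w_0\|_{X_1\times X}^2\qquad\text{for all }t>0\text{ and all }w_0\in(X_2\times X_1)\setminus\{0\}.$$ Let $\mathcal K^{-1}(r)=\inf\{s\ge0:\mathcal K(s)<r\}$ for $r>0$. (a) If $g(s)=1$, then, with $T_0=\mathcal K^{-1}\!\left(\tfrac12\right)$, the exact observability inequality $$\|w_0\|_{X_1\times X}^2\le4\int_0^t\|\mathcal CU(s)\|_Y^2\,ds\qquad\text{for all }w_0\in X_2\times X_1$$ holds for all $t\ge T_0$. (b) If $g(s)=s$, then for every $w_0\in(X_2\times X_1)\setminus\{0\}$ the weak observability inequality $$\|w_0\|_{X_1\times X}^2\le4\int_0^t\|\mathcal CU(s)\|_Y^2\,ds$$ holds for all $t\ge\mathcal T(\mu(w_0))$, where $\mathcal T\in\Sigma_i$ (as a function on the set of values of the frequency function $\mu$, i.e. continuous, positive and non-decreasing there) is defined by $$\mathcal T(\mu(w_0))=\mathcal K^{-1}\!\left(\frac1{2\mu(w_0)}\right).$$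
   Context: $X$ is a complex separable Hilbert space, $A:D(A)\subset X\to X$ is a (linear, unbounded) self-adjoint positive operator with compact resolvent, $0\notin\sigma(A)$. For $\beta\ge0$, $X_\beta=D(A^{\beta/2})$ with norm $\|z\|_\beta=\|A^{\beta/2}z\|_X$. $Y$ is a complex Hilbert space identified with its dual, and $C\in\mathcal L(X,Y)$ is a bounded operator with adjoint $C^*\in\mathcal L(Y,X)$. The space $X_1\times X$ carries the norm $\|(x_0,x_1)\|_{X_1\times X}^2=\|A^{1/2}x_0\|_X^2+\|x_1\|_X^2$ and the corresponding inner product. Define $\mathcal A(x_0,x_1)=(x_1,-Ax_0)$ with domain $\mathcal D(\mathcal A)=X_2\times X_1$ (a skew-adjoint operator in $X_1\times X$ generating the unitary group $(e^{t\mathcal A})_{t\in\mathbb R}$), $\mathcal C(x_0,x_1)=Cx_1$, so $\mathcal C\in\mathcal L(X_1\times X,Y)$, with adjoint $\mathcal C^*y=(0,C^*y)$. The damped system is the first-order form of $z''+Az+C^*Cz'=0$ with $w=(z,z')$; the undamped system $U'=\mathcal AU$ is that of $x''+Ax=0$. Let $(\lambda_k)_{k\ge1}$ be the eigenvalues of $A$ (non-decreasing, repeated with multiplicity), $(\varphi_k)_{k\ge1}$ a corresponding orthonormal eigenbasis of $X$, $\mu_k=\sqrt{\lambda_k}$ and $\mu_{-k}=-\mu_k$. For $k\ge1$ let $\phi_{\pm k}=\frac1{\sqrt2}\left(\frac1{i\mu_k}\varphi_k,\pm\varphi_k\right)$; these form an orthonormal basis of eigenvectors of $\mathcal A$ in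 $X_1\times X$, $\mathcal A\phi_k=i\mu_k\phi_k$ for $k\in\mathbb Z^*=\mathbb Z\setminus\{0\}$. The frequency function is, for $U_0\in(X_2\times X_1)\setminus\{0\}$, $$\mu(U_0)=\frac{\sum_{k\in\mathbb Z^*}\mu_{|k|}\,|\langle U_0,\phi_k\rangle_{X_1\times X}|^2}{\sum_{k\in\mathbb Z^*}|\langle U_0,\phi_k\rangle_{X_1\times X}|^2}.$$ $\Sigma_d^0$ is the set of continuous, (strictly) decreasing functions $\mathcal K:[0,\infty)\to(0,\infty)$ with $\lim_{t\to+\infty}\mathcal K(t)=0$. $\Sigma_i$ is the set of continuous even functions $\mathbb R\to(0,\infty)$ that are non-decreasing on $[0,\infty)$; functions of the frequency are only relevant on its set of values. *)

(* Defs.v *)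
From HB Require Import structures.
From mathcomp Require Import all_boot all_order all_algebra sesquilinear.
From mathcomp Require Import complex.
From mathcomp Require Import all_classical all_reals all_analysis.

Set Implicit Arguments.
Unset Strict Implicit.
Unset Printing Implicit Defensive.

Import Order.TTheory GRing.Theory Num.Theory.
Import numFieldNormedType.Exports.

Local Open Scope ring_scope.
Local Open Scope classical_set_scope.
Local Open Scope complex_scope.

Local Notation normc := ComplexField.Normc.normc.

(* Complex Hilbert spaces; the inner product is linear in its first argument.
   The library norm of a normed module over R[i] takes its values in R[i]. *)
HB.mixin Record isHilbert (R : realType) X of CompleteNormedModule R[i] X := {
  hdot : {dot X for (@Num.conj R[i])};
  hdotE : forall x : X, hdot x x = `|x| ^+ 2
}.

#[short(type="hilbertType")]
HB.structure Definition Hilbert (R : realType) :=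
  {X of isHilbert R X & CompleteNormedModule R[i] X}.

Arguments hdot {R s}.

Definition hnorm (R : realType) (X : hilbertType R) (x : X) : R :=
  complex.Re `|x|.

Definition separable (T : topologicalType) : Prop :=
  exists2 S : set T, countable S & dense S.

Section UnboundedOperators.
Context {R : realType} {X : hilbertType R}.

Record unbounded_operator := UnboundedOperator {
  dom : set X;
  app :> X -> X;
  dom0 : dom 0;
  dom_linear : forall (a : R[i]) x y, dom x -> dom y -> dom (a *: x + y);
  app_linear : forall (a : R[i]) x y, dom x -> dom y ->
    app (a *: x + y) = a *: app x + app y
}.

Implicit Types (A : unbounded_operator) (z : R[i]).

(* The right-hand side is the graph of A; the left-hand side that of A^*. *)
Definition self_adjoint A : Prop :=
  dense (dom A) /\
  forall y y', (forall x, dom A x -> hdot (A x) y = hdot x y') <->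
               (dom A y /\ A y = y').

Definition positive_operator A : Prop :=
  forall x, dom A x -> 0 <= hdot (A x) x.

Definition is_resolvent A z (Rz : {linear X -> X}) : Prop :=
  [/\ continuous Rz,
      forall y, dom A (Rz y) /\ z *: Rz y - A (Rz y) = y &
      forall x, dom A x -> Rz (z *: x - A x) = x].

Definition resolvent_set A : set R[i] :=
  [set z | exists Rz : {linear X -> X}, is_resolvent A z Rz].

Definition spectrum A : set R[i] := ~` resolvent_set A.

Definition compact_operator (T : X -> X) : Prop :=
  compact (closure (T @` [set x | `|x| <= 1])).

(* By the resolvent identity, one compact resolvent makes them all compact. *)
Definition compact_resolvent A : Prop :=
  exists z (Rz : {linear X -> X}), is_resolvent A z Rz /\ compact_operator Rz.

Definition orthonormal_basis (phi : nat -> X) : Prop :=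
  (forall j k, hdot (phi j) (phi k) = (j == k)%:R) /\
  (forall x, series (fun k => hdot x (phi k) *: phi k) @ \oo --> x).

(* Shifted indexing: lam k and phi k stand for lambda_{k+1}, varphi_{k+1}. *)
Definition eigenbasis A (lam : nat -> R) (phi : nat -> X) : Prop :=
  [/\ nondecreasing_seq lam,
      orthonormal_basis phi &
      forall k, dom A (phi k) /\ A (phi k) = (lam k)%:C *: phi k].

End UnboundedOperators.
Arguments unbounded_operator {R} X.

Section Spaces.
Context {R : realType} {X : hilbertType R}.
Variables (A : unbounded_operator X) (lam : nat -> R) (phi : nat -> X).

(* The power A^s, by the functional calculus in the eigenbasis. *)
Definition dom_pow (s : R) : set X :=
  [set x | cvgn (series (fun k =>
     lam k `^ (2 * s) * normc (hdot x (phi k)) ^+ 2))].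

Definition op_pow (s : R) (x : X) : X :=
  limn (series (fun k => (lam k `^ s)%:C *: (hdot x (phi k) *: phi k))).

Definition Xspace (beta : R) : set X := dom_pow (beta / 2).

Definition Xnorm (beta : R) (x : X) : R := hnorm (op_pow (beta / 2) x).

(* X_1 x X is the set of pairs u with u.1 in Xspace 1. *)
Definition Edot (u v : X * X) : R[i] :=
  hdot (op_pow (1 / 2) u.1) (op_pow (1 / 2) v.1) + hdot u.2 v.2.

Definition Enorm (u : X * X) : R :=
  Num.sqrt (Xnorm 1 u.1 ^+ 2 + hnorm u.2 ^+ 2).

(* X_2 = D(A^{2/2}) is D(A). *)
Definition Edom : set (X * X) := [set u | dom A u.1 /\ Xspace 1 u.2].

Definition Ewave (u : X * X) : X * X := (u.2, - A u.1).

Definition freq_mu (k : int) : R := Num.sqrt (lam `|k|.-1).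

(* phi_k for k in Z^*; freq_mu k is mu_{|k|}. *)
Definition mode (k : int) : X * X :=
  ((Num.sqrt 2)^-1)%:C *:
    (('i * (freq_mu k)%:C)^-1 *: phi `|k|.-1, (sgz k)%:~R *: phi `|k|.-1).

Definition Zstar : set int := [set k | k != 0].

Definition frequency (u : X * X) : R :=
  fine (\esum_(k in Zstar) (freq_mu k * normc (Edot u (mode k)) ^+ 2)%:E) /
  fine (\esum_(k in Zstar) (normc (Edot u (mode k)) ^+ 2)%:E).

Definition frequency_values : set R :=
  frequency @` (Edom `&` [set u | u != 0]).

(* Classical solution on [0, +oo[ of u' = G u, u(0) = u0, with u(t) in Edom;
   the derivative is taken in the norm of X_1 x X and is one-sided at 0. *)
Definition solution (G : X * X -> X * X) (u0 : X * X) (u : R -> X * X) : Prop :=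
  u 0 = u0 /\
  forall t, 0 <= t ->
    Edom (u t) /\
    Enorm ((h^-1)%:C *: (u (t + h) - u t) - G (u t))
      @[h --> within [set h | 0 <= t + h] 0^'] --> (0 : R).

Context {Y : hilbertType R}.
Variables (C : X -> Y) (Cadj : Y -> X).

Definition Eobs (u : X * X) : Y := C u.2.

Definition Eobs_adj (y : Y) : X * X := (0, Cadj y).

Definition Edamped (u : X * X) : X * X := Ewave u - Eobs_adj (Eobs u).

End Spaces.

Definition Sigma_d0 (R : realType) (K : R -> R) : Prop :=
  [/\ {within `[0, +oo[, continuous K},
      {in `[0, +oo[ &, {homo K : x y /~ x < y}},
      forall t, 0 <= t -> 0 < K t &
      K t @[t --> +oo] --> (0 : R)].

Definition Kinv (R : realType) (K : R -> R) (r : R) : R :=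
  inf [set s | 0 <= s /\ K s < r].

(* Main.v *)
(* Let z = U - w. Then z' = Az + C^*C w (A skew-adjoint here), so
     (|z|^2 - |w|^2 / 2)' = 2 Re <CU, Cw> - |Cw|^2 <= |CU|^2,
   and since z(0) = 0, integration gives
     (|w_0|^2 - |w(t)|^2) / 2 <= int_0^t |CU|^2.
   At time t >= K^{-1}(1 / (2 g(mu))) the decay estimate gives
   |w(t)|^2 <= |w_0|^2 / 2, whence the factor 4. The frequency enters only through
   the decay estimate at t = 0, namely 1 <= K(0) g(mu): it makes mu and the
   observation time positive, and keeps 1 / (2 mu) in the range of K, where
   K^{-1} is a true continuous decreasing inverse. *)

Require Import Defs.
From HB Require Import structures.
From mathcomp Require Import all_boot all_order all_algebra sesquilinear.
From mathcomp Require Import complex.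
From mathcomp Require Import ring lra.
From mathcomp Require Import all_classical all_reals all_analysis.

Set Implicit Arguments.
Unset Strict Implicit.
Unset Printing Implicit Defensive.

Import Order.TTheory GRing.Theory Num.Theory.
Import numFieldNormedType.Exports.

Local Open Scope ring_scope.
Local Open Scope classical_set_scope.
Local Open Scope complex_scope.

(** * Real inner product and real-valued norm of a complex Hilbert space *)

Section HilbertGeometry.
Context {R : realType} {X : hilbertType R}.
Implicit Types (x y z : X) (r : R).

(** Energies and their derivatives are real; this form is symmetric and bilinear over [R], so rules
    on the left transfer to the right. *)
Definition rdot x y : R := complex.Re (hdot x y).

Lemma norm_hnorm x : `|x| = (hnorm x)%:C.
Proof.
rewrite /hnorm; have : 0 <= `|x| by [].
by rewrite lecE => /andP[/eqP /= i0 _]; rewrite [LHS]complexE i0 mulr0 addr0.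
Qed.

Lemma hnorm_ge0 x : 0 <= hnorm x.
Proof. by have := normr_ge0 x; rewrite norm_hnorm lecR. Qed.

Lemma hdotxx x : hdot x x = (hnorm x ^+ 2)%:C.
Proof. by rewrite hdotE norm_hnorm rmorphXn. Qed.

Lemma rdotxx x : rdot x x = hnorm x ^+ 2.
Proof. by rewrite /rdot hdotxx. Qed.

Lemma hdotC x y : hdot x y = (hdot y x)^*.
Proof. by rewrite (hermC hdot) expr0 mul1r. Qed.

Lemma rdotC x y : rdot x y = rdot y x.
Proof. by rewrite /rdot hdotC; case: (hdot y x). Qed.

Lemma rdotDl x y z : rdot (x + y) z = rdot x z + rdot y z.
Proof. by rewrite /rdot linearDl raddfD. Qed.

Lemma rdotNl x z : rdot (- x) z = - rdot x z.
Proof. by rewrite /rdot linearNl raddfN. Qed.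

Lemma rdotDr x y z : rdot z (x + y) = rdot z x + rdot z y.
Proof. by rewrite rdotC rdotDl !(rdotC z). Qed.

Lemma rdotNr x z : rdot z (- x) = - rdot z x.
Proof. by rewrite rdotC rdotNl (rdotC z). Qed.

Lemma rdot0l x : rdot 0 x = 0.
Proof. by rewrite /rdot linear0l. Qed.

Lemma rdot_suml (I : Type) (r : seq I) (P : pred I) (f : I -> X) y :
  rdot (\sum_(i <- r | P i) f i) y = \sum_(i <- r | P i) rdot (f i) y.
Proof.
by apply: (big_morph (rdot^~ y)) => [u v|]; [exact: rdotDl|exact: rdot0l].
Qed.

Lemma rdot_sumr (I : Type) (r : seq I) (P : pred I) (f : I -> X) y :
  rdot y (\sum_(i <- r | P i) f i) = \sum_(i <- r | P i) rdot y (f i).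
Proof. by rewrite rdotC rdot_suml; apply: eq_bigr => i _; rewrite rdotC. Qed.

Lemma rdotBl x y z : rdot (x - y) z = rdot x z - rdot y z.
Proof. by rewrite rdotDl rdotNl. Qed.

Lemma rdotBr x y z : rdot z (x - y) = rdot z x - rdot z y.
Proof. by rewrite rdotDr rdotNr. Qed.

Lemma Re_realM r (c : R[i]) : complex.Re (r%:C * c) = r * complex.Re c.
Proof. by case: c => a b /=; rewrite mul0r subr0. Qed.

Lemma rdotZl r x y : rdot (r%:C *: x) y = r * rdot x y.
Proof. by rewrite /rdot linearZl_LR Re_realM. Qed.

Lemma rdotZr r x y : rdot x (r%:C *: y) = r * rdot x y.
Proof. by rewrite rdotC rdotZl rdotC. Qed.

Lemma hnorm0 : hnorm (0 : X) = 0.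
Proof. by rewrite /hnorm normr0. Qed.

Lemma hnorm_eq0 x : hnorm x = 0 -> x = 0.
Proof. by move=> x0; apply/normr0_eq0; rewrite norm_hnorm x0. Qed.

(* Continuity of the inner product comes from polarization, as the Cauchy-Schwarz
   inequality of [sesquilinear] is limited to finite dimension. *)
Lemma rdot_polar x y :
  rdot x y = (hnorm (x + y) ^+ 2 - hnorm (x - y) ^+ 2) / 4.
Proof.
rewrite -!rdotxx !(rdotDl, rdotDr, rdotNl, rdotNr) (rdotC y x).
apply: (@mulIf _ 4); first by rewrite pnatr_eq0.
by rewrite divfK ?pnatr_eq0 //; ring.
Qed.

(** In the order of [R[i]] every positive number is real, so both convergences quantify over the
    same tolerances. *)
Lemma cvg_hnormP (T : Type) (F : set_system T) {FF : Filter F} (f : T -> X) x :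
  f @ F --> x <-> (hnorm (f t - x) @[t --> F] --> (0 : R)).
Proof.
split=> [fx|fx].
- apply/cvgr0Pnorm_lt => e e0.
  have /cvgrPdist_lt/(_ e%:C) := fx; rewrite ltcR => /(_ e0).
  apply: filterS => t; rewrite distrC norm_hnorm ltcR.
  by rewrite ger0_norm // hnorm_ge0.
- apply/cvgrPdist_lt => -[a b]; rewrite ltcE /= => /andP[/eqP -> a0].
  have /cvgr0Pnorm_lt/(_ a a0) := fx.
  apply: filterS => t; rewrite distrC norm_hnorm (ltcR _ a).
  by rewrite ger0_norm // hnorm_ge0.
Qed.

Lemma ler_hnormD x y : hnorm (x + y) <= hnorm x + hnorm y.
Proof. by have := ler_normD x y; rewrite !norm_hnorm -rmorphD lecR. Qed.

Lemma hnormN x : hnorm (- x) = hnorm x.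
Proof. by rewrite /hnorm normrN. Qed.

Lemma ler_hnorm_dist x y : `|hnorm x - hnorm y| <= hnorm (x - y).
Proof.
rewrite ler_norml; apply/andP; split.
  rewrite lerNl opprB lerBlDr -(hnormN (x - y)) opprB.
  by rewrite (le_trans _ (ler_hnormD _ _)) // subrK.
by rewrite lerBlDr (le_trans _ (ler_hnormD _ _)) // subrK.
Qed.

Lemma cvg_hnorm (T : Type) (F : set_system T) {FF : Filter F} (f : T -> X) x :
  f @ F --> x -> hnorm (f t) @[t --> F] --> hnorm x.
Proof.
move=> /cvg_hnormP fx; apply/cvgrPdist_lt => e e0.
have /cvgr0Pnorm_lt/(_ e e0) := fx; apply: filterS => t.
rewrite (ger0_norm (hnorm_ge0 _)); apply: le_lt_trans.
by rewrite distrC ler_hnorm_dist.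
Qed.

Lemma cvg_rdot (T : Type) (F : set_system T) {FF : Filter F} (f g : T -> X)
    x y : f @ F --> x -> g @ F --> y ->
  rdot (f t) (g t) @[t --> F] --> rdot x y.
Proof.
move=> fx gy; rewrite rdot_polar.
under eq_cvg do rewrite rdot_polar !expr2.
have fgD : hnorm (f t + g t) @[t --> F] --> hnorm (x + y).
  by apply: cvg_hnorm; apply: cvgD.
have fgB : hnorm (f t - g t) @[t --> F] --> hnorm (x - y).
  by apply: cvg_hnorm; apply: cvgB.
by rewrite !expr2; apply: cvgMr_tmp; apply: cvgB; apply: cvgM.
Qed.

End HilbertGeometry.

Local Notation normc := ComplexField.Normc.normc.

(** * Eigenfunction expansions and the square root of [A] *)

Section Powers.
Context {R : realType} {X : hilbertType R}.
Variables (A : unbounded_operator X) (lam : nat -> R) (phi : nat -> X).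
Hypotheses (Asa : self_adjoint A) (Apos : positive_operator A).
Hypotheses (A0 : ~ spectrum A 0) (phiE : eigenbasis A lam phi).
Implicit Types (x y : X) (c d : R[i]) (j k m n : nat).

Local Notation root k := (lam k `^ (1 / 2)).

(** The limit taken in [op_pow] is meaningful only if these partial sums converge, so their
    convergence is carried as an explicit hypothesis. *)
Definition root_series x : X^nat :=
  series (fun k => (root k)%:C *: (hdot x (phi k) *: phi k)).

Lemma normcE2 c : normc c ^+ 2 = complex.Re (c * c^*).
Proof.
by case: c => a b /=; rewrite sqr_sqrtr ?addr_ge0 ?sqr_ge0 // mulrN opprK -!expr2.
Qed.

Lemma hdot_phi j k : hdot (phi j) (phi k) = (j == k)%:R.
Proof. by case: phiE => _ [+ _] _; apply. Qed.

Lemma hdot_phiZ c d j k :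
  hdot (c *: phi j) (d *: phi k) = c * d^* * (j == k)%:R.
Proof. by rewrite linearZl_LR linearZr_LR /= hdot_phi mulrA. Qed.

(** Pythagoras, by induction on the upper bound: the last term is orthogonal to the earlier ones. *)
Lemma hnorm_sum_phi (c : nat -> R[i]) m n :
  hnorm (\sum_(m <= k < n) c k *: phi k) ^+ 2
  = \sum_(m <= k < n) normc (c k) ^+ 2.
Proof.
have [nm|mn] := leqP n m; first by rewrite !big_geq // hnorm0 expr0n.
elim: n mn => // n IHn; rewrite ltnS leq_eqVlt => /predU1P[->|mn].
  by rewrite !big_nat1 -rdotxx /rdot hdot_phiZ eqxx mulr1 normcE2.
rewrite !(big_nat_recr n) //=; try exact: ltnW.
rewrite -IHn // -!rdotxx rdotDl !rdotDr [rdot (c n *: _) (\sum_(_ <= _ < _) _)]rdotC.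
suff -> : rdot (\sum_(m <= i < n) c i *: phi i) (c n *: phi n) = 0.
  by rewrite addr0 add0r /rdot hdot_phiZ eqxx mulr1 normcE2.
rewrite rdot_suml big_nat big1 // => k /andP[_ kn].
by rewrite /rdot hdot_phiZ (ltn_eqF kn) mulr0.
Qed.

Lemma riesz_fischer (c : nat -> R[i]) :
  cvgn (series (fun k => normc (c k) ^+ 2)) ->
  cvgn (series (fun k => c k *: phi k)).
Proof.
move=> /cauchy_cvgP/cauchy_seriesP cn; apply/cauchy_cvgP/cauchy_seriesP.
move=> -[a b]; rewrite ltcE /= => /andP[/eqP -> a0].
(* The squared norm of a vector tail is the scalar tail, hence the tolerance [a ^+ 2] for [a]. *)
have := cn (a ^+ 2) (exprn_gt0 _ a0); apply: filterS => -[m n] /=.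
rewrite -hnorm_sum_phi ger0_norm ?sqr_ge0 // norm_hnorm (ltcR _ a).
by rewrite ltr_pXn2r // nnegrE ?hnorm_ge0 // ltW.
Qed.

Lemma lam_ge0 k : 0 <= lam k.
Proof.
case: phiE => _ _ /(_ k)[dphi Aphi].
have := Apos dphi; rewrite Aphi linearZl_LR /= hdot_phi eqxx mulr1.
by rewrite lecR.
Qed.

Lemma root_sqr k : root k ^+ 2 = lam k.
Proof.
rewrite -powR_mulrn ?powR_ge0 // -powRrM mul1r mulVf ?pnatr_eq0 //.
by rewrite powRr1 // lam_ge0.
Qed.

Lemma root_termE x k :
  normc ((root k)%:C * hdot x (phi k)) ^+ 2
  = lam k * normc (hdot x (phi k)) ^+ 2.
Proof.
rewrite !normcE2 -[in RHS]root_sqr; move: (root k) => r.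
by case: (hdot _ _) => a b /=; ring.
Qed.

Lemma cvg_root_series x :
  cvgn (series (fun k => lam k * normc (hdot x (phi k)) ^+ 2)) ->
  cvgn (root_series x).
Proof.
move=> cx; rewrite /root_series.
under eq_fun do rewrite scalerA.
by apply: riesz_fischer; under eq_fun do rewrite root_termE.
Qed.

Lemma Xspace1_cvg x : Xspace lam phi 1 x -> cvgn (root_series x).
Proof.
move=> cx; apply: cvg_root_series; move: cx; rewrite /Xspace /dom_pow /=.
suff -> : (fun k => lam k `^ (2 * (1 / 2)) * normc (hdot x (phi k)) ^+ 2)
        = (fun k => lam k * normc (hdot x (phi k)) ^+ 2) by [].
apply/funext => k.
by rewrite (mulrC 2) divfK ?pnatr_eq0 // powRr1 ?lam_ge0.
Qed.

(** The graph of [A] is that of its adjoint; the equivalence is read from right to left at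
    [y' = A y]. *)
Lemma hdot_app_sym x y : dom A x -> dom A y -> hdot (A x) y = hdot x (A y).
Proof.
move=> dx dy; have [_ /(_ y (A y))[_ ]] := Asa.
by move=> /(_ (conj dy erefl)); apply.
Qed.

Lemma hdot_phi_app c k y : dom A y ->
  hdot (c *: phi k) (A y) = (lam k)%:C * (c * (hdot y (phi k))^*).
Proof.
move=> dy; case: phiE => _ _ /(_ k)[dphi Aphi].
by rewrite linearZl_LR /= -hdot_app_sym // Aphi linearZl_LR /= hdotC mulrCA.
Qed.

Lemma basis_cvg x : series (fun k => hdot x (phi k) *: phi k) @ \oo --> x.
Proof. by case: phiE => _ [_ +] _; apply. Qed.

(* The partial sums of [sum_k lam_k |x_k|^2] are [Re <S_n x, A x>], where [S_n x]
   is the n-th partial sum of the expansion of [x]. *)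
Lemma dom_cvg x : dom A x -> cvgn (root_series x).
Proof.
move=> dx; apply: cvg_root_series.
have -> : series (fun k => lam k * normc (hdot x (phi k)) ^+ 2)
        = (fun n => rdot (series (fun k => hdot x (phi k) *: phi k) n) (A x)).
  apply/funext => n; rewrite /series rdot_suml.
  apply: eq_bigr => k _; rewrite /rdot hdot_phi_app // Re_realM normcE2.
  by [].
apply: cvgP; apply: cvg_rdot; [exact: basis_cvg|exact: cvg_cst].
Qed.

Lemma root_seriesP (a : R[i]) x y :
  cvgn (root_series x) -> cvgn (root_series y) ->
  cvgn (root_series (a *: x + y)) /\
  op_pow lam phi (1 / 2) (a *: x + y)
  = a *: op_pow lam phi (1 / 2) x + op_pow lam phi (1 / 2) y.
Proof.
move=> cx cy.
have E : root_series (a *: x + y)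
       = (fun n => a *: root_series x n + root_series y n).
  apply/funext => n; rewrite /root_series /series /= scaler_sumr -big_split /=.
  apply: eq_bigr => k _.
  by rewrite linearPl /= scalerDl scalerDr !scalerA mulrCA mulrA.
have L : root_series (a *: x + y) @ \oo -->
    a *: limn (root_series x) + limn (root_series y).
  by rewrite E; apply: cvgD => //; apply: cvgZl_tmp.
by split; [exact: cvgP L|exact/cvg_lim].
Qed.

(** The pairing passes to the limit, and against a single mode only the [k]-th term survives. *)
Lemma rdot_phi_root c k y : cvgn (root_series y) ->
  rdot (c *: phi k) (op_pow lam phi (1 / 2) y)
  = root k * complex.Re (c * (hdot y (phi k))^*).
Proof.
move=> cy; have L : rdot (c *: phi k) (root_series y n) @[n --> \oo] -->
    rdot (c *: phi k) (op_pow lam phi (1 / 2) y).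
  by apply: cvg_rdot => //; exact: cvg_cst.
apply: (cvg_unique _ L) => //.
(* The partial sum of index [n] stops before [n], so it contains mode [k] from [k.+1] on. *)
apply: cvg_near_cst; exists k.+1 => // n /= kn.
rewrite /root_series /series /= rdot_sumr.
rewrite (bigD1_seq k) /= ?mem_index_iota ?iota_uniq // big1 ?addr0 => [|j jk].
  rewrite scalerA /rdot hdot_phiZ eqxx mulr1 rmorphM /=.
  rewrite [Num.conj _%:C]conjc_real mulrCA.
  by rewrite Re_realM.
by rewrite scalerA /rdot hdot_phiZ eq_sym (negPf jk) mulr0.
Qed.

(** Both sides are limits of one sequence, obtained by truncating the expansion of [x]. This is the
    identity behind the skew-adjointness of the wave operator, with [x] only in the domain of the
    square root. *)
Lemma rdot_root x y : cvgn (root_series x) -> dom A y ->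
  rdot (op_pow lam phi (1 / 2) x) (op_pow lam phi (1 / 2) y) = rdot x (A y).
Proof.
move=> cx dy; have cy := dom_cvg dy; set ry := op_pow _ _ _ y.
have Lx : rdot (root_series x n) ry @[n --> \oo] -->
    rdot (op_pow lam phi (1 / 2) x) ry.
  by apply: cvg_rdot => //; exact: cvg_cst.
apply: (cvg_unique _ Lx) => //.
have -> : (fun n => rdot (root_series x n) ry)
  = (fun n => rdot (series (fun k => hdot x (phi k) *: phi k) n) (A y)).
  apply/funext => n; rewrite /root_series /series !rdot_suml.
  apply: eq_bigr => k _; rewrite rdotZl rdot_phi_root //.
  by rewrite /rdot hdot_phi_app // Re_realM -[in RHS]root_sqr expr2 mulrA.
exact: (cvg_rdot (@basis_cvg x) (cvg_cst (A y))).
Qed.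

(** As 0 lies in the resolvent set, [x = A y] for some [y], and
    [|x|^2 = <A^{1/2} x, A^{1/2} y> = 0]. *)
Lemma root_inj x : cvgn (root_series x) -> op_pow lam phi (1 / 2) x = 0 -> x = 0.
Proof.
move=> cx x0; have : resolvent_set A 0 by apply: contrapT.
(* The resolvent at 0 inverts [- A], hence the argument [- x]. *)
case=> R0 [_ /(_ (- x)) [dRx]]; rewrite scale0r sub0r => /oppr_inj ARx _.
apply: hnorm_eq0; apply/eqP; rewrite -sqrf_eq0 -rdotxx -{2}ARx -rdot_root //.
by rewrite x0 /rdot linear0l.
Qed.

End Powers.

(** * One-sided calculus on the half-line *)

Section HalfLine.
Context {R : realType}.
Implicit Types (f : R -> R) (s t : R).

(* The filter along which [solution] takes its difference quotients at [s]. *)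
Definition half_nbhs s : set_system R := within [set h | 0 <= s + h] 0^'.

Global Instance half_nbhs_filter s : Filter (half_nbhs s).
Proof. exact: within_filter. Qed.

Lemma half_nbhs_ge0 s : \forall h \near half_nbhs s, 0 <= s + h.
Proof. by rewrite /half_nbhs near_withinE; near=> h. Unshelve. all: by end_near. Qed.

(** Away from 0 the constraint in [half_nbhs] is void for small [h], so its limits there are
    two-sided; only at 0 are they right limits. *)
Lemma near_shift_ge0 s : 0 < s -> \forall h \near (0 : R), 0 <= s + h.
Proof.
move=> s0; near=> h; rewrite -lerBlDl sub0r; apply: ltW; near: h.
by apply: lt_nbhsr; rewrite oppr_lt0.
Unshelve. all: by end_near. Qed.

Lemma cvg_half_at_right f s : 0 <= s ->
  f (s + h) @[h --> half_nbhs s] --> f s -> f x @[x --> s^'+] --> f s.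
Proof.
move=> s0 /cvgrPdist_lt fs; apply/cvgrPdist_lt => e /fs.
rewrite /half_nbhs /dnbhs /at_right !near_withinE => fe.
apply/(nbhs0P (fun x => s < x -> `|f s - f x| < e)); apply: filterS fe.
move=> h fe; rewrite ltrDl => h0.
by apply: fe; [rewrite gt_eqF|rewrite /= addr_ge0 // ltW].
Qed.

Lemma cvg_half_continuous f s : 0 < s ->
  f (s + h) @[h --> half_nbhs s] --> f s -> {for s, continuous f}.
Proof.
move=> s0 /cvgrPdist_lt fs; apply/cvgrPdist_lt => e e0; move: (fs e e0).
rewrite /half_nbhs /dnbhs !near_withinE => fe.
have hs := near_shift_ge0 s0.
apply/(nbhs0P (fun x => `|f s - f x| < e)); apply: filterS2 fe hs => h fe hs.
have [->|h0] := eqVneq h 0; first by rewrite addr0 subrr normr0.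
exact: fe.
Qed.

Lemma half_within_continuous f t : 0 < t ->
  (forall s, 0 <= s -> f (s + h) @[h --> half_nbhs s] --> f s) ->
  {within `[0, t], continuous f}.
Proof.
move=> t0 fc; apply/(continuous_within_itvP _ t0); split.
- move=> x; rewrite in_itv /= => /andP[x0 _].
  by apply: cvg_half_continuous => //; apply: fc; exact: ltW.
- by apply: cvg_half_at_right => //; apply: fc.
- apply: cvg_at_left_filter; apply: cvg_half_continuous => //.
  by apply: fc; exact: ltW.
Qed.

Lemma half_is_derive f df s : 0 < s ->
  h^-1 * (f (s + h) - f s) @[h --> half_nbhs s] --> df -> is_derive s 1 f df.
Proof.
move=> s0 fs.
have L : h^-1 *: ((f \o shift s) (h *: 1) - f s) @[h --> 0^'] --> df.
  apply/cvgrPdist_lt => e e0; have /cvgrPdist_lt/(_ e e0) := fs.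
  rewrite /half_nbhs /dnbhs !near_withinE => fe.
  have hs := near_shift_ge0 s0.
  apply: filterS2 fe hs => h fe hs h0.
  by have := fe h0 hs; rewrite /= /GRing.scale /= mulr1 (addrC h).
by split; [exact: cvgP L|exact/cvg_lim].
Qed.

(** The fundamental theorem of calculus for [q], then monotonicity of the integral. *)
Lemma half_integral_le (q dq f : R -> R) t : 0 < t ->
  (forall s, 0 <= s ->
     h^-1 * (q (s + h) - q s) @[h --> half_nbhs s] --> dq s) ->
  (forall s, 0 <= s -> dq (s + h) @[h --> half_nbhs s] --> dq s) ->
  (forall s, 0 <= s -> f (s + h) @[h --> half_nbhs s] --> f s) ->
  (forall s, 0 <= s -> dq s <= f s) ->
  ((q t - q 0)%:E <= \int[lebesgue_measure]_(s in `[0%R, t]) (f s)%:E)%E.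
Proof.
move=> t0 qd dqc fc le_dqf.
(* Differentiability gives continuity: [h] times the quotient is the increment, also at [h = 0]. *)
have qc s : 0 <= s -> q (s + h) @[h --> half_nbhs s] --> q s.
  move=> s0; rewrite -[q s]addr0 -(mul0r (dq s)).
  have -> : (fun h => q (s + h)) = (fun h => q s + h * (h^-1 * (q (s + h) - q s))).
    apply/funext => h; have [->|h0] := eqVneq h 0; first by rewrite addr0 mul0r addr0.
    by rewrite mulrA mulfV // mul1r addrCA subrr addr0.
  apply: cvgD; first exact: cvg_cst.
  by apply: cvgM (qd s s0); do 2!apply: cvg_within_filter; exact: cvg_id.
have D (x : R) : 0 < x -> is_derive x 1 q (dq x).
  by move=> x0; apply: half_is_derive => //; apply: qd; exact: ltW.
have dqt := half_within_continuous t0 dqc.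
rewrite EFinB -(continuous_FTC2 t0 dqt).
- apply: le_integral => //.
  + apply: continuous_compact_integrable => //; exact: segment_compact.
  + apply: continuous_compact_integrable; first exact: segment_compact.
    exact: half_within_continuous.
  + move=> x; rewrite inE /= in_itv /= => /andP[x0 _].
    by rewrite lee_fin le_dqf.
- split.
  + by move=> x; rewrite in_itv /= => /andP[/D[]].
  + by apply: cvg_half_at_right => //; exact: qc.
  + apply: cvg_at_left_filter; apply: cvg_half_continuous => //.
    by apply: qc; exact: ltW.
- move=> x; rewrite in_itv /= => /andP[/D Dx _].
  by rewrite derive1E derive_val.
Qed.

End HalfLine.

(** * The inverse of a strictly decreasing decay rate *)

Section InverseDecay.
Context {R : realType}.
Variable K : R -> R.
Hypothesis KP : Sigma_d0 K.
Implicit Types (r s t : R).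

Lemma decay_lt s t : 0 <= s -> s < t -> K t < K s.
Proof.
case: KP => _ Kd _ _ s0 st.
by apply: Kd => //; rewrite !inE /= in_itv /= andbT // (le_trans s0) ?ltW.
Qed.

Lemma decay_lt_inv s t : 0 <= t -> K t < K s -> s < t.
Proof.
move=> t0 Kts; rewrite ltNge le_eqVlt; apply/negP => /predU1P[ts|].
  by move: Kts; rewrite ts ltxx.
by move=> /(decay_lt t0)/(lt_trans Kts); rewrite ltxx.
Qed.

(** Strict decrease turns the sublevel set into the open half-line beyond [s], whose infimum is
    [s]. *)
Lemma Kinv_decay s : 0 <= s -> Kinv K (K s) = s.
Proof.
move=> s0; rewrite /Kinv -[RHS](@inf_itv _ +oo%O false) //.
congr inf; apply/seteqP; split=> x /=; rewrite in_itv /= andbT.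
  by move=> [x0 ]; exact: decay_lt_inv.
by move=> sx; split; [rewrite (le_trans s0) ?ltW|exact: decay_lt].
Qed.

(** [K] tends to 0, so it falls below [r] at some [M]; the intermediate value theorem applies on
    [[0, M]]. *)
Lemma decay_surj r : 0 < r <= K 0 -> exists2 s, 0 <= s & K s = r.
Proof.
case: KP => Kc _ _ Klim /andP[r0 rK].
have [M [M0 KM]] : exists M, 0 < M /\ K M < r.
  have /cvgr0Pnorm_lt/(_ r r0) KM := Klim.
  have M0 : \forall M \near +oo, (0 : R) < M := nbhs_pinfty_gt (num_real 0).
  have [M [MK M1]] := filter_ex (filterI KM M0).
  by exists M; split => //; rewrite (le_lt_trans (ler_norm _)).
have [||s + sr] := @IVT _ K 0 M r (ltW M0).
- apply: continuous_subspaceW Kc => x /=.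
  by rewrite !in_itv /= => /andP[->].
- by rewrite ge_min le_max (ltW KM) rK orbT.
by rewrite in_itv /= => /andP[s0 _]; exists s.
Qed.

Lemma KinvP r : 0 < r <= K 0 -> 0 <= Kinv K r /\ K (Kinv K r) = r.
Proof. by move=> /decay_surj[s s0 <-]; rewrite Kinv_decay. Qed.

Lemma Kinv_gt0 r : 0 < r < K 0 -> 0 < Kinv K r.
Proof.
move=> /andP[r0 rK]; have [|_ KK] := @KinvP r; first by rewrite r0 ltW.
have [|s0 _] := @KinvP r; first by rewrite r0 ltW.
by apply: decay_lt_inv; rewrite ?KK.
Qed.

Lemma Kinv_anti r r' : 0 < r -> r <= r' -> r' <= K 0 -> Kinv K r' <= Kinv K r.
Proof.
move=> r0 rr' rK; have [|s0 sr] := @KinvP r; first by rewrite r0 (le_trans rr').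
have [|s0' sr'] := @KinvP r'; first by rewrite rK (lt_le_trans r0).
by rewrite leNgt; apply/negP => /(decay_lt s0); rewrite sr sr' ltNge rr'.
Qed.

Lemma decay_le_Kinv r t : 0 < r <= K 0 -> Kinv K r <= t -> K t <= r.
Proof.
move=> /KinvP[s0 sr]; rewrite le_eqVlt => /predU1P[<-|]; first by rewrite sr.
by move=> /(decay_lt s0); rewrite sr => /ltW.
Qed.

Lemma decay_cvg0 : K x @[x --> 0^'+] --> K 0.
Proof.
have [Kc _ _ _] := KP.
have : {within `[0, 1], continuous K}.
  apply: continuous_subspaceW Kc => x /=.
  by rewrite !in_itv /= => /andP[->].
by move=> /(continuous_within_itvP _ ltr01)[].
Qed.

(** On [V] the argument lies strictly between 0 and [K 0]. For [a < s < b], nearby arguments stay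
    between [K b] and [K a], which traps their preimages between [a] and [b]. *)
Lemma Kinv_continuous (V : set R) :
  (forall m, V m -> 0 < m /\ 1 <= K 0 * m) ->
  {within V, continuous (fun m => Kinv K (1 / (2 * m)))}.
Proof.
move=> VP.
have Kr m : V m -> 0 < 1 / (2 * m) < K 0.
  move=> /VP[m0 Km]; rewrite divr_gt0 ?mulr_gt0 //=.
  by rewrite ltr_pdivrMr ?mulr_gt0 //; lra.
have Kr' m : V m -> 0 < 1 / (2 * m) <= K 0.
  by move=> /Kr /andP[-> /ltW].
apply/subspace_continuousP => m Vm; apply/cvgrPdist_lt => e e0.
have [s0 sr] := KinvP (Kr' m Vm); have {}s0 := Kinv_gt0 (Kr m Vm).
set s := Kinv K _ in s0 sr *.
(* Both points are within [e / 2] of [s]; the maximum with [s / 2] keeps [a] in the half-line where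
   [K] decreases. *)
pose a := Num.max (s / 2) (s - e / 2); pose b := s + e / 2.
have a0 : 0 <= a by rewrite le_max divr_ge0 // ltW.
have as_ : a < s by rewrite gt_max; apply/andP; split; lra.
have sa : s - e / 2 <= a by rewrite le_max lexx orbT.
have sb : s < b by rewrite /b; lra.
have b0 : 0 <= b by rewrite (le_trans (ltW s0)) ?ltW.
have Kas : K s < K a by exact: decay_lt.
have Kbs : K b < K s by apply: decay_lt => //; exact: ltW.
have L : 1 / (2 * x) @[x --> within V (nbhs m)] --> K s.
  rewrite sr; apply: cvg_within_filter; apply: cvgMl_tmp; apply: cvgV.
    by rewrite mulf_neq0 ?pnatr_eq0 // gt_eqF //; case: (VP m Vm).
  by apply: cvgMl_tmp; exact: cvg_id.
near=> x; have Vx : V x by near: x; rewrite near_withinE; near=> y.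
have [x0 xr] := KinvP (Kr' x Vx).
have ax : a < Kinv K (1 / (2 * x)).
  by apply: decay_lt_inv => //; rewrite xr; near: x; apply: (cvgr_lt (K s)).
have xb : Kinv K (1 / (2 * x)) < b.
  by apply: decay_lt_inv => //; rewrite xr; near: x; apply: (cvgr_gt (K s)).
rewrite /b in xb; rewrite ltr_norml; apply/andP; split; lra.
Unshelve. all: by end_near. Qed.

End InverseDecay.

(** * Differentiation of Hilbert-valued curves *)

Section Curves.
Context {R : realType} {X : hilbertType R}.
Implicit Types (a b : R -> X) (x : X) (t : R).

Definition diffq a t (h : R) : X := (h^-1)%:C *: (a (t + h) - a t).

Lemma hnormZ (r : R) (x : X) : hnorm (r%:C *: x) = `|r| * hnorm x.
Proof.
apply: (pexpIrn (n := 2)); rewrite ?nnegrE ?mulr_ge0 ?hnorm_ge0 //.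
by rewrite -rdotxx rdotZl rdotZr exprMn real_normK ?num_real // -rdotxx mulrA expr2.
Qed.

Lemma diffqB a b t h : diffq (fun s => a s - b s) t h = diffq a t h - diffq b t h.
Proof. by rewrite /diffq -scalerBr !opprD !opprK addrACA. Qed.

(** The increment has norm [|h|] times that of the quotient, which converges. *)
Lemma diffq_cvg a x t : diffq a t h @[h --> half_nbhs t] --> x ->
  a (t + h) @[h --> half_nbhs t] --> a t.
Proof.
move=> /cvg_hnorm ax; apply/cvg_hnormP.
have -> : (fun h => hnorm (a (t + h) - a t)) = (fun h => `|h| * hnorm (diffq a t h)).
  apply/funext => h; rewrite -hnormZ /diffq scalerA -rmorphM /=.
  have [->|h0] := eqVneq h 0; first by rewrite addr0 subrr scaler0.
  by rewrite mulfV // scale1r.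
rewrite -(mul0r (hnorm x)) -(normr0 R); apply: cvgM => //.
by apply: cvg_norm; do 2!apply: cvg_within_filter; exact: cvg_id.
Qed.

Lemma diffq_energy a x t : diffq a t h @[h --> half_nbhs t] --> x ->
  h^-1 * (hnorm (a (t + h)) ^+ 2 - hnorm (a t) ^+ 2) @[h --> half_nbhs t]
    --> 2 * rdot (a t) x.
Proof.
move=> ax; have ac := diffq_cvg ax.
(* Product rule: the increment is paired once with the new value and once with the old one. *)
have -> : (fun h => h^-1 * (hnorm (a (t + h)) ^+ 2 - hnorm (a t) ^+ 2))
  = (fun h => rdot (diffq a t h) (a (t + h)) + rdot (a t) (diffq a t h)).
  apply/funext => h; rewrite /diffq rdotZl rdotZr -mulrDr rdotBl rdotBr !rdotxx.
  by rewrite addrA subrK.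
rewrite mulr2n mulrDl !mul1r {1}rdotC.
by apply: cvgD; apply: cvg_rdot => //; exact: cvg_cst.
Qed.

End Curves.

(** * Energy comparison of damped and undamped solutions *)

Section Damping.
Context {R : realType} {X Y : hilbertType R}.
Variables (A : unbounded_operator X) (lam : nat -> R) (phi : nat -> X).
Hypotheses (Asa : self_adjoint A) (Apos : positive_operator A).
Hypotheses (phiE : eigenbasis A lam phi).
Variables (C : {linear X -> Y}) (Cadj : {linear Y -> X}).
Hypotheses (Cc : continuous C) (CC : forall x y, hdot (C x) y = hdot x (Cadj y)).
Implicit Types (x y : X) (z : X * X).

Local Notation op := (op_pow lam phi (1 / 2)).
Local Notation cvg_op x := (cvgn (root_series lam phi x)).

Lemma root_seriesB x y : cvg_op x -> cvg_op y ->
  cvg_op (x - y) /\ op (x - y) = op x - op y.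
Proof.
move=> cx cy; have := root_seriesP (-1) cy cx.
by rewrite !scaleN1r !(addrC (- _)).
Qed.

Lemma root_seriesZ (c : R[i]) x : cvg_op x ->
  cvg_op (c *: x) /\ op (c *: x) = c *: op x.
Proof.
(* The zero second summand is produced as [x - x], which comes with the convergence of its root
   series. *)
move=> cx; have [c0 op0] := root_seriesB cx cx; have := root_seriesP c cx c0.
by rewrite op0 !subrr !addr0.
Qed.

Lemma Enorm_sqr z : Enorm lam phi z ^+ 2 = hnorm (op z.1) ^+ 2 + hnorm z.2 ^+ 2.
Proof. by rewrite sqr_sqrtr // addr_ge0 ?sqr_ge0. Qed.

Lemma hnorm1_le_Enorm z : hnorm (op z.1) <= Enorm lam phi z.
Proof.
rewrite -(ler_pXn2r (n := 2)) ?nnegrE ?hnorm_ge0 ?sqrtr_ge0 // Enorm_sqr.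
by rewrite lerDl sqr_ge0.
Qed.

Lemma hnorm2_le_Enorm z : hnorm z.2 <= Enorm lam phi z.
Proof.
rewrite -(ler_pXn2r (n := 2)) ?nnegrE ?hnorm_ge0 ?sqrtr_ge0 // Enorm_sqr.
by rewrite lerDr sqr_ge0.
Qed.

(** The energy norm dominates both components, so a solution gives two derivatives in [X], the first
    one after applying the square root. Both systems share the equation for the first component. *)
Lemma solution_diffq (G : X * X -> X * X) z0 (u : R -> X * X) t :
  (forall z, Edom A lam phi z -> (G z).1 = z.2) ->
  solution A lam phi G z0 u -> 0 <= t ->
  diffq (fun s => op (u s).1) t h @[h --> half_nbhs t] --> op (u t).2 /\
  diffq (fun s => (u s).2) t h @[h --> half_nbhs t] --> (G (u t)).2.
Proof.
move=> G1 [_ usol] t0; have [ut /cvgr0Pnorm_lt udiff] := usol t t0.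
have cvg1 s : 0 <= s -> cvg_op (u s).1.
  by move=> /usol[[+ _] _]; exact: (dom_cvg Asa Apos phiE).
have cvg2 : cvg_op (u t).2 by case: ut => _; exact: (Xspace1_cvg Apos phiE).
split; apply/cvg_hnormP; apply/cvgr0Pnorm_lt => e e0.
(* Linearity of the square root inside the quotient needs convergence at [t + h], known for
   nonnegative times. *)
- apply: filterS2 (udiff e e0) (half_nbhs_ge0 t) => h uh th.
  rewrite !ger0_norm ?hnorm_ge0 ?sqrtr_ge0 // in uh *.
  apply: le_lt_trans uh; apply: le_trans (hnorm1_le_Enorm _).
  rewrite /= G1 // /diffq.
  have [c1 <-] := root_seriesB (cvg1 _ th) (cvg1 _ t0).
  have [c2 <-] := root_seriesZ (h^-1)%:C c1.
  by have [_ ->] := root_seriesB c2 cvg2.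
- apply: filterS (udiff e e0) => h uh.
  rewrite !ger0_norm ?hnorm_ge0 ?sqrtr_ge0 // in uh *.
  by apply: le_lt_trans uh; apply: le_trans (hnorm2_le_Enorm _).
Qed.

Lemma domB x y : dom A x -> dom A y -> dom A (x - y) /\ A (x - y) = A x - A y.
Proof.
move=> dx dy; have := dom_linear (-1) dy dx; have := app_linear (-1) dy dx.
by rewrite !scaleN1r !(addrC (- _)).
Qed.

Variables (z0 : X * X) (w U : R -> X * X).
Hypothesis wsol : solution A lam phi (Edamped A C Cadj) z0 w.
Hypothesis Usol : solution A lam phi (Ewave A) z0 U.

Local Notation wdiffq :=
  (solution_diffq (fun z _ => subr0 z.2 : (Edamped A C Cadj z).1 = z.2) wsol).
Local Notation Udiffq :=
  (solution_diffq (fun z _ => erefl : (Ewave A z).1 = z.2) Usol).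

(* The derivative of this function is [2 Re <CU, Cw> - |Cw|^2 <= |CU|^2]. *)
Let q s := hnorm (op (U s).1 - op (w s).1) ^+ 2 + hnorm ((U s).2 - (w s).2) ^+ 2
  - 2^-1 * (hnorm (op (w s).1) ^+ 2 + hnorm (w s).2 ^+ 2).

Let dq s := 2 * rdot (C (U s).2) (C (w s).2) - hnorm (C (w s).2) ^+ 2.

Lemma rdot_adj x (y : Y) : rdot x (Cadj y) = rdot (C x) y.
Proof. by rewrite /rdot CC. Qed.

Lemma defect_diffq s : 0 <= s ->
  h^-1 * (q (s + h) - q s) @[h --> half_nbhs s] --> dq s.
Proof.
move=> s0; have [w1 w2] := wdiffq s0; have [U1 U2] := Udiffq s0.
have z1 : diffq (fun r => op (U r).1 - op (w r).1) s h @[h --> half_nbhs s]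
    --> op (U s).2 - op (w s).2.
  by under eq_cvg do rewrite diffqB; exact: cvgB.
have z2 : diffq (fun r => (U r).2 - (w r).2) s h @[h --> half_nbhs s]
    --> (Ewave A (U s)).2 - (Edamped A C Cadj (w s)).2.
  by under eq_cvg do rewrite diffqB; exact: cvgB.
have L := cvgB (cvgD (diffq_energy z1) (diffq_energy z2))
  (cvgM (cvg_cst (2^-1 : R)) (cvgD (diffq_energy w1) (diffq_energy w2))).
have [[dU XU] _] := Usol.2 s s0; have [[dw Xw] _] := wsol.2 s s0.
have cU2 := Xspace1_cvg Apos phiE XU; have cw2 := Xspace1_cvg Apos phiE Xw.
have cU1 := dom_cvg Asa Apos phiE dU; have cw1 := dom_cvg Asa Apos phiE dw.
have [dz Az] := domB dU dw.
have [_ op1] := root_seriesB cU1 cw1; have [cz op2] := root_seriesB cU2 cw2.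
(* These two identities, for [U - w] and for [w], cancel all terms in [A]; only the damping terms
   remain. *)
have zz := rdot_root Asa Apos phiE cz dz.
have ww := rdot_root Asa Apos phiE cw2 dw.
move: zz ww; rewrite op1 op2 Az => zz ww.
have <- : 2 * rdot (op (U s).1 - op (w s).1) (op (U s).2 - op (w s).2) +
   2 * rdot ((U s).2 - (w s).2) ((Ewave A (U s)).2 - (Edamped A C Cadj (w s)).2) -
   2^-1 * (2 * rdot (op (w s).1) (op (w s).2)
     + 2 * rdot (w s).2 (Edamped A C Cadj (w s)).2) = dq s.
  rewrite [rdot (_ - _) (_ - _)]rdotC zz [rdot (op _) (op _)]rdotC ww /dq /=.
  by rewrite /Eobs !(rdotBr, rdotBl, rdotNr) !rdot_adj rdotxx; field.
apply: cvg_trans (L _ _ _ _ _); apply: near_eq_cvg; apply: nearW => h.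
by rewrite /q !fctE /=; ring.
Qed.

(** Used at [s = 0], where the decay estimate is passed to the limit at initial time. *)
Lemma energy_cvg s : 0 <= s ->
  Enorm lam phi (w (s + h)) ^+ 2 @[h --> half_nbhs s] --> Enorm lam phi (w s) ^+ 2.
Proof.
move=> s0; have [/diffq_cvg/cvg_hnorm w1 /diffq_cvg/cvg_hnorm w2] := wdiffq s0.
rewrite Enorm_sqr !expr2; under eq_cvg do rewrite Enorm_sqr !expr2.
by apply: cvgD; apply: cvgM.
Qed.

Lemma defect_le t : 0 < t ->
  ((2^-1 * (Enorm lam phi z0 ^+ 2 - Enorm lam phi (w t) ^+ 2))%:E <=
   \int[lebesgue_measure]_(s in `[0%R, t]) (hnorm (Eobs C (U s)) ^+ 2)%:E)%E.
Proof.
move=> t0.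
have C_cvg (a : R -> X) s : a (s + h) @[h --> half_nbhs s] --> a s ->
    C (a (s + h)) @[h --> half_nbhs s] --> C (a s).
  by apply: continuous_cvg; exact: Cc.
(* The solutions start together, so [q 0] is minus half the initial energy; the energy of [U - w] at
   time [t] is dropped. *)
have q_t : 2^-1 * (Enorm lam phi z0 ^+ 2 - Enorm lam phi (w t) ^+ 2)
    <= q t - q 0.
  rewrite !Enorm_sqr /q wsol.1 Usol.1 !subrr !hnorm0 expr0n /=.
  by rewrite addr0 sub0r opprK mulrBr addrC lerD2r lerDr addr_ge0 ?sqr_ge0.
apply: (@le_trans _ _ (q t - q 0)%:E); first by rewrite lee_fin.
apply: (half_integral_le (dq := dq)) => //.
- exact: defect_diffq.
- move=> s s0; have [_ /diffq_cvg w2] := wdiffq s0.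
  have [_ /diffq_cvg U2] := Udiffq s0.
  have Cw := C_cvg (fun r => (w r).2) s w2; have CU := C_cvg (fun r => (U r).2) s U2.
  rewrite /dq expr2; under eq_cvg do rewrite expr2.
  apply: cvgB; first by apply: cvgM; [exact: cvg_cst|exact: cvg_rdot].
  by apply: cvgM; exact: cvg_hnorm.
- move=> s s0; have [_ /diffq_cvg U2] := Udiffq s0.
  have CU := C_cvg (fun r => (U r).2) s U2.
  rewrite /Eobs expr2; under eq_cvg do rewrite expr2.
  by apply: cvgM; exact: cvg_hnorm.
- move=> s s0; rewrite /dq /Eobs -subr_ge0.
  (* The difference [|CU|^2 - dq] is exactly [|CU - Cw|^2]. *)
  have := sqr_ge0 (hnorm (C (U s).2 - C (w s).2)).
  by rewrite -!rdotxx rdotBl !rdotBr (rdotC (C (w s).2)); lra.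
Qed.

End Damping.

(** * From decay to observability for a single initial datum *)

Section Observability.
Context {R : realType} {X Y : hilbertType R}.
Variables (A : unbounded_operator X) (lam : nat -> R) (phi : nat -> X).
Hypotheses (Asa : self_adjoint A) (Apos : positive_operator A).
Hypotheses (A0 : ~ spectrum A 0) (phiE : eigenbasis A lam phi).
Variables (C : {linear X -> Y}) (Cadj : {linear Y -> X}).
Hypotheses (Cc : continuous C) (CC : forall x y, hdot (C x) y = hdot x (Cadj y)).
Variable K : R -> R.
Hypothesis KP : Sigma_d0 K.

(** Zero energy kills the second component directly and the first through injectivity of the square
    root. *)
Lemma Enorm_gt0 (z : X * X) : dom A z.1 -> z != 0 -> 0 < Enorm lam phi z.
Proof.
move=> dz; rewrite lt0r sqrtr_ge0 andbT; apply: contra_neq => z0.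
have z1 : z.1 = 0.
  apply: (root_inj Asa Apos A0 phiE); first exact: (dom_cvg Asa Apos phiE).
  apply: hnorm_eq0; apply: le_anti.
  by rewrite hnorm_ge0 (le_trans (hnorm1_le_Enorm _ _ _)) ?z0.
have z2 : z.2 = 0.
  apply: hnorm_eq0; apply: le_anti.
  by rewrite hnorm_ge0 (le_trans (hnorm2_le_Enorm lam phi _)) ?z0.
by case: z z1 z2 {dz z0} => a b /= -> ->.
Qed.

(** The root of 0 is computed as a difference of two equal convergent series. This serves the zero
    datum, absent from the decay hypothesis. *)
Lemma Enorm0 : Enorm lam phi 0 = 0.
Proof.
have c0 := dom_cvg Asa Apos phiE (dom0 A).
have [_ op0] := root_seriesB c0 c0; rewrite !subrr in op0.
by apply/eqP; rewrite -sqrf_eq0 Enorm_sqr /= op0 hnorm0 expr0n addr0.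
Qed.

Variables (z0 : X * X) (w U : R -> X * X) (c : R).
Hypothesis wsol : solution A lam phi (Edamped A C Cadj) z0 w.
Hypothesis Usol : solution A lam phi (Ewave A) z0 U.
Hypotheses (dz0 : Edom A lam phi z0) (z0_neq0 : z0 != 0).
Hypothesis decay : forall t, 0 < t ->
  Enorm lam phi (w t) ^+ 2 <= K t * c * Enorm lam phi z0 ^+ 2.

(* Letting [t] tend to 0 in the decay estimate forces [1 / (2 * c) < K 0], so that
   [Kinv K (1 / (2 * c))] is a genuine preimage and not 0. *)
Lemma decay_rate_ge1 : 1 <= K 0 * c.
Proof.
have N0 : 0 < Enorm lam phi z0 ^+ 2 by rewrite exprn_gt0 // Enorm_gt0 //; case: dz0.
rewrite -(ler_pM2r N0) mul1r.
have L : Enorm lam phi (w t) ^+ 2 @[t --> 0^'+] --> Enorm lam phi z0 ^+ 2.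
  rewrite -[in X in _ --> X]wsol.1.
  apply: (@cvg_half_at_right _ (fun t => Enorm lam phi (w t) ^+ 2)) => //.
  exact: (energy_cvg Asa Apos phiE wsol).
have KL : K t * c * Enorm lam phi z0 ^+ 2 @[t --> 0^'+] -->
    K 0 * c * Enorm lam phi z0 ^+ 2.
  apply: cvgM; last exact: cvg_cst.
  by apply: cvgM; [exact: decay_cvg0|exact: cvg_cst].
apply: (ler_cvg_to L KL); near=> t; apply: decay; near: t.
exact: nbhs_right_gt.
Unshelve. all: by end_near. Qed.

(** When [c] is the frequency, its positivity is thus read off the decay estimate and not off its
    defining series. *)
Lemma decay_rate_gt0 : 0 < c.
Proof.
have [_ _ K_gt0 _] := KP; have K0 := K_gt0 0 (lexx 0).
by rewrite -(pmulr_rgt0 c K0) (lt_le_trans ltr01) // decay_rate_ge1.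
Qed.

(** Here [c] stands for [g] at the frequency of [z0]. Past the threshold [K t * c <= 1 / 2], so at
    least half the energy is dissipated and [defect_le] applies. *)
Lemma observability t : Kinv K (1 / (2 * c)) <= t ->
  ((Enorm lam phi z0 ^+ 2)%:E <= 4%:E *
    \int[lebesgue_measure]_(s in `[0%R, t]) (hnorm (Eobs C (U s)) ^+ 2)%:E)%E.
Proof.
move=> Tt; have c0 := decay_rate_gt0; have Kc := decay_rate_ge1.
have r0 : 0 < 1 / (2 * c) by rewrite divr_gt0 ?mulr_gt0.
have rK : 1 / (2 * c) < K 0 by rewrite ltr_pdivrMr ?mulr_gt0 //; lra.
(* The decay estimate is available only at positive times, hence the need for a positive
   threshold. *)
have t0 : 0 < t by rewrite (lt_le_trans _ Tt) // Kinv_gt0 // r0.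
have Kt : K t <= 1 / (2 * c) by apply: decay_le_Kinv Tt => //; rewrite r0 ltW.
have half : Enorm lam phi (w t) ^+ 2 <= 2^-1 * Enorm lam phi z0 ^+ 2.
  apply: (le_trans (decay t0)); rewrite ler_wpM2r ?sqr_ge0 //.
  apply: le_trans (ler_wpM2r (ltW c0) Kt) _.
  by rewrite mul1r invfM -mulrA mulVf ?mulr1 // gt_eqF.
have four_ge0 : (0 <= 4%:E :> \bar R)%E by rewrite lee_fin.
apply: le_trans (lee_wpmul2l four_ge0 (defect_le Asa Apos phiE Cc CC wsol Usol t0)).
(* One factor 2 pays for the [2^-1] of [defect_le], the other for the remaining half of the
   energy. *)
by rewrite -EFinM lee_fin; lra.
Qed.

End Observability.

Theorem theorem2p3 (R : realType) (X Y : hilbertType R)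
  (hX : separable X)
  (A : unbounded_operator X)
  (hAsa : self_adjoint A) (hApos : positive_operator A)
  (hAcpt : compact_resolvent A) (hA0 : ~ spectrum A 0)
  (lam : nat -> R) (phi : nat -> X) (hphi : eigenbasis A lam phi)
  (C : {linear X -> Y}) (hC : continuous C)
  (Cadj : {linear Y -> X}) (hCadj : continuous Cadj)
  (hCC : forall x y, hdot (C x) y = hdot x (Cadj y))
  (K : R -> R) (hK : Sigma_d0 K)
  (g : R -> R) (hg : (forall s, g s = 1) \/ (forall s, g s = s))
  (w U : X * X -> R -> X * X)
  (hw : forall w0, Edom A lam phi w0 ->
     solution A lam phi (Edamped A C Cadj) w0 (w w0))
  (hU : forall w0, Edom A lam phi w0 ->
     solution A lam phi (Ewave A) w0 (U w0))
  (hstab : forall t, 0 < t -> forall w0, Edom A lam phi w0 -> w0 != 0 ->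
     Enorm lam phi (w w0 t) ^+ 2 <=
       K t * g (frequency lam phi w0) * Enorm lam phi w0 ^+ 2) :
  ((forall s, g s = 1) ->
     forall t, Kinv K (1 / 2) <= t -> forall w0, Edom A lam phi w0 ->
       ((Enorm lam phi w0 ^+ 2)%:E <=
         4%:E * \int[lebesgue_measure]_(s in `[0%R, t])
                  (hnorm (Eobs C (U w0 s)) ^+ 2)%:E)%E)
  /\
  ((forall s, g s = s) ->
     let T := fun m : R => Kinv K (1 / (2 * m)) in
     [/\ {within frequency_values A lam phi, continuous T},
         (forall m, frequency_values A lam phi m -> 0 < T m),
         {in frequency_values A lam phi &, {homo T : m m' / m <= m'}} &
         forall w0, Edom A lam phi w0 -> w0 != 0 ->
         forall t, T (frequency lam phi w0) <= t ->
           ((Enorm lam phi w0 ^+ 2)%:E <=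
             4%:E * \int[lebesgue_measure]_(s in `[0%R, t])
                      (hnorm (Eobs C (U w0 s)) ^+ 2)%:E)%E]).
Proof.
(* Each frequency value is the constant [c] of some decaying trajectory and inherits both bounds. *)
have hfreq (g_id : forall s, g s = s) m : frequency_values A lam phi m ->
    0 < m /\ 1 <= K 0 * m.
  move=> [w0 [dw0 /= nz0] <-]; have dec t : 0 < t -> Enorm lam phi (w w0 t) ^+ 2
      <= K t * frequency lam phi w0 * Enorm lam phi w0 ^+ 2.
    by move=> t0; rewrite -[frequency _ _ _]g_id; exact: hstab.
  split; first exact: (decay_rate_gt0 hAsa hApos hA0 hphi hK (hw w0 dw0) dw0 nz0 dec).
  exact: (decay_rate_ge1 hAsa hApos hA0 hphi hK (hw w0 dw0) dw0 nz0 dec).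
have K_le m : 0 < m /\ 1 <= K 0 * m -> 0 < 1 / (2 * m) < K 0.
  move=> [m0 Km]; rewrite divr_gt0 ?mulr_gt0 //=.
  by rewrite ltr_pdivrMr ?mulr_gt0 //; lra.
split=> [g1 t Tt w0 dw0|g_id T].
  (* The decay hypothesis excludes the zero datum, for which the claim is nonnegativity of the
     integral. *)
  have [->|nz0] := eqVneq w0 0.
    rewrite (Enorm0 hAsa hApos hphi) expr0n; apply: mule_ge0; first by rewrite lee_fin.
    by apply: integral_ge0 => s _; rewrite lee_fin sqr_ge0.
  apply: (observability hAsa hApos hA0 hphi hC hCC hK (hw w0 dw0) (hU w0 dw0)
    (c := 1)) => //.
  - by move=> s s0; have := hstab s s0 w0 dw0 nz0; rewrite g1.
  - by rewrite mulr1.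
split.
- exact/(Kinv_continuous hK)/hfreq.
- by move=> m /(hfreq g_id)/K_le; exact: Kinv_gt0.
(* Two order reversals compose: [m] to [1 / (2 * m)], then [Kinv K]. *)
- move=> m m' /set_mem/(hfreq g_id) hm /set_mem/(hfreq g_id) hm' mm'.
  have /andP[r0 _] := K_le m' hm'; have /andP[_ /ltW rK] := K_le m hm.
  apply: Kinv_anti => //; rewrite !mul1r lef_pV2 ?posrE ?mulr_gt0 ?hm.1 ?hm'.1 //.
  by rewrite ler_pM2l.
- move=> w0 dw0 nz0 t Tt.
  apply: (observability hAsa hApos hA0 hphi hC hCC hK (hw w0 dw0) (hU w0 dw0)) Tt => //.
  by move=> s s0; have := hstab s s0 w0 dw0 nz0; rewrite g_id.
Qed.
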